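(* Consider the stochastic shortest path problem described in the context. Assume that the cost per stage is bounded, i.e., $\sup_{(x,u,w)\in X\times U\times W}g(x,u,w)<\infty$, and that there exists a uniformly proper policy. Assume further that either there exists a $\delta>0$ such that $Q^*_\delta(x,u)<\infty$ for all $x\in X^*$ and $u\in U(x)$, or the set $W$ is finite. Then: (a) $\hat J$ is the unique solution $J$, within the set $\widehat{\mathcal W}_b$, of the Bellman equation $$J(x)=\inf_{u\in U(x)}E\big\{g(x,u,w)+J(f(x,u,w))\big\},\qquad x\in X.$$ Moreover, if $\hat J=J^*$, then $J^*$ is the unique solution of this Bellman equation within $\mathcal B$. (b) If $\{J_k\}$ is the sequence generated by the value iteration algorithm $$J_{k+1}(x)=\inf_{u\in U(x)}E\big\{g(x,u,w)+J_k(f(x,u,w))\big\},\qquad x\in X,\ k=0,1,\ldots,$$ starting with some $J_0\in\mathcal B$ with $J_0\ge\hat J$, then $J_k\to\hat J$ pointwise.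
   Context: Problem. $X$ (states) and $U$ (controls) are arbitrary sets; $W$ (disturbances) is a countable set. For each $x\in X$ there is a nonempty constraint set $U(x)\subset U$. The system is $x_{k+1}=f(x_k,u_k,w_k)$, $k=0,1,\ldots$, with $f:X\times U\times W\to X$, where $w_k$ has given probability distribution $P(w_k\mid x_k,u_k)$ on $W$. The cost per stage is a function $g$ on $X\times U\times W$ with nonnegative, finite expected value: $0\le E\{g(x,u,w)\}<\infty$ for all $x\in X$, $u\in U(x)$, where $E$ is with respect to $P(w\mid x,u)$. There is a special destination state $t\in X$ that is cost-free and absorbing: $f(t,u,w)=t$ and $g(t,u,w)=0$ for all $u\in U(t)$, $w\in W$. Policies. A policy is a sequence $\pi=\{\mu_0,\mu_1,\ldots\}$ of functions $\mu_k:X\to U$ with $\mu_k(x)\in U(x)$ for all $x$; $\Pi$ is the set of all policies. $E^\pi_{x_0}$ is expectation with respect to the probability measure on trajectories induced by initial state $x_0$ and policy $\pi$. The cost function of $\pi$ is $J_\pi(x_0)=\sum_{k=0}^\infty E^\pi_{x_0}\{g(x_k,\mu_k(x_k),w_k)\}\in[0,\infty]$. The optimal cost function is $J^*(x)=\inf_{\pi\in\Pi}J_\pi(x)$, and $X^*=\{x\in X\mid J^*(x)<\infty\}$. Proper policies. Let $r_k(\pi,x)$ be the probability that $x_k\ne t$ when using $\pi$ and starting from $x_0=x$. A policy $\pi$ is proper at $x$ if $J_\pi(x)<\infty$ and $\sum_{k=0}^\infty r_k(\pi,x)<\infty$. $\widehat\Pi_x$ is the set of policies that are proper at $x$; $\hat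 J(x)=\inf_{\pi\in\widehat\Pi_x}J_\pi(x)$ (with $\inf\emptyset=\infty$); $\widehat X=\{x\in X\mid\hat J(x)<\infty\}$. A policy $\pi$ is uniformly proper if $\sup_{x\in\widehat X}\sum_{k=0}^\infty r_k(\pi,x)<\infty$. Perturbed problem. For $\delta>0$, the $\delta$-perturbed problem is the same problem with cost per stage $g(x,u,w)+\delta$ for $x\ne t$, and $g(t,u,w)=0$ unchanged. Its cost functions are $J_{\pi,\delta}(x)=J_\pi(x)+\delta\sum_{k=0}^\infty r_k(\pi,x)$ and its optimal cost function is $\hat J_\delta(x)=\inf_{\pi\in\Pi}J_{\pi,\delta}(x)$. Define $Q^*_\delta(x,u)=E\{g(x,u,w)+\delta+\hat J_\delta(f(x,u,w))\}$. Function sets. $\mathcal J$ is the set of functions $J:X\to[0,\infty]$ with $J(t)=0$; $\mathcal B=\{J\in\mathcal J\mid\sup_{x\in\widehat X}J(x)<\infty\}$; $\widehat{\mathcal W}_b=\{J\in\mathcal B\mid\hat J\le J\}$. All inequalities and limits between functions are pointwise. *)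

(* Defs.v *)
From mathcomp Require Export all_boot all_order all_algebra.
From mathcomp Require Export all_classical all_reals all_analysis.

Set Implicit Arguments.
Unset Strict Implicit.
Unset Printing Implicit Defensive.

Import Order.TTheory GRing.Theory Num.Theory.
Import numFieldNormedType.Exports.

Local Open Scope classical_set_scope.
Local Open Scope ring_scope.
Local Open Scope ereal_scope.

(* Expectation of h under the probability mass function p, as the difference
   of the expectations of its positive and negative parts. Here 0 * +oo = 0,
   and +oo - +oo = -oo, so that 0 <= expect p h < +oo forces both parts to
   have finite expectation. *)
Definition expect (R : realType) (T : choiceType) (p : T -> R)
    (h : T -> \bar R) : \bar R :=
  \esum_(a in [set: T]) ((p a)%:E * h^\+ a)
  - \esum_(a in [set: T]) ((p a)%:E * h^\- a).

(* The cost function is only required to have a nonnegative finite expected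
   value; it may itself take negative values. *)
Record ssp (R : realType) (X U : Type) (W : countType) := SSP {
  feasible : X -> set U;
  dyn : X -> U -> W -> X;
  prob : X -> U -> W -> R;
  cost : X -> U -> W -> R;
  dest : X;
  feasible_nonempty : forall x, feasible x !=set0;
  prob_ge0 : forall x u, feasible x u -> forall w, (0 <= prob x u w)%R;
  prob_sum1 : forall x u, feasible x u ->
    \esum_(w in [set: W]) (prob x u w)%:E = 1;
  cost_expect : forall x u, feasible x u ->
    0 <= expect (prob x u) (fun w => (cost x u w)%:E) < +oo;
  dyn_dest : forall u w, feasible dest u -> dyn dest u w = dest;
  cost_dest : forall u w, feasible dest u -> cost dest u w = 0%R }.

Section SSPDefs.
Variables (R : realType) (X U : Type) (W : countType) (S : ssp R X U W).

Definition policies : set (nat -> X -> U) :=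
  [set pi | forall k x, feasible S x (pi k x)].

Definition shift (pi : nat -> X -> U) : nat -> X -> U := fun k => pi k.+1.

(* The state x_k reached from x_0 = x under pi when the first disturbances
   ws = [:: w_0; ..; w_(k-1)] occur, k = size ws. *)
Fixpoint state (pi : nat -> X -> U) (x : X) (ws : seq W) : X :=
  if ws is w :: ws' then state (shift pi) (dyn S x (pi 0%N x) w) ws' else x.

(* The probability of observing exactly the initial disturbances ws. *)
Fixpoint traj_prob (pi : nat -> X -> U) (x : X) (ws : seq W) : R :=
  if ws is w :: ws' then
    (prob S x (pi 0%N x) w
     * traj_prob (shift pi) (dyn S x (pi 0%N x) w) ws')%R
  else 1%R.

(* W being countable, the trajectory measure is determined by its discrete
   marginals on the first n disturbances, on which x_0, .., x_n depend. *)
Definition traj_expect (pi : nat -> X -> U) (x : X) (n : nat)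
    (h : n.-tuple W -> \bar R) : \bar R :=
  expect (fun ws : n.-tuple W => traj_prob pi x ws) h.

Definition stage_cost (pi : nat -> X -> U) (x : X) (k : nat) : \bar R :=
  traj_expect pi x (fun ws : k.+1.-tuple W =>
    let xk := state pi x (take k ws) in
    (cost S xk (pi k xk) (tnth ws ord_max))%:E).

Definition Jpol (pi : nat -> X -> U) (x : X) : \bar R :=
  \sum_(0 <= k <oo) stage_cost pi x k.

Definition Jstar (x : X) : \bar R := ereal_inf [set Jpol pi x | pi in policies].

Definition Xstar : set X := [set x | Jstar x < +oo].

(* The probability r_k(pi, x) that x_k <> t. *)
Definition notdest_prob (pi : nat -> X -> U) (x : X) (k : nat) : \bar R :=
  \esum_(ws in [set ws : k.-tuple W | state pi x ws <> dest S])
    (traj_prob pi x ws)%:E.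

Definition notdest_sum (pi : nat -> X -> U) (x : X) : \bar R :=
  \sum_(0 <= k <oo) notdest_prob pi x k.

Definition proper_at (x : X) : set (nat -> X -> U) :=
  [set pi | [/\ policies pi, Jpol pi x < +oo & notdest_sum pi x < +oo]].

Definition Jhat (x : X) : \bar R :=
  ereal_inf [set Jpol pi x | pi in proper_at x].

Definition Xhat : set X := [set x | Jhat x < +oo].

Definition uniformly_proper (pi : nat -> X -> U) : Prop :=
  policies pi /\ ereal_sup [set notdest_sum pi x | x in Xhat] < +oo.

Definition Jpol_pert (delta : R) (pi : nat -> X -> U) (x : X) : \bar R :=
  Jpol pi x + delta%:E * notdest_sum pi x.

Definition Jhat_pert (delta : R) (x : X) : \bar R :=
  ereal_inf [set Jpol_pert delta pi x | pi in policies].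

Definition Qstar_pert (delta : R) (x : X) (u : U) : \bar R :=
  expect (prob S x u)
    (fun w => (cost S x u w)%:E + delta%:E + Jhat_pert delta (dyn S x u w)).

Definition calJ : set (X -> \bar R) :=
  [set J | (forall x, 0 <= J x) /\ J (dest S) = 0].

Definition calB : set (X -> \bar R) :=
  [set J | calJ J /\ ereal_sup [set J x | x in Xhat] < +oo].

Definition calWb : set (X -> \bar R) :=
  [set J | calB J /\ forall x, Jhat x <= J x].

Definition bellman (J : X -> \bar R) (x : X) : \bar R :=
  ereal_inf [set expect (prob S x u)
                   (fun w => (cost S x u w)%:E + J (dyn S x u w))
            | u in feasible S x].

Definition bellman_solution (J : X -> \bar R) : Prop :=
  forall x, J x = bellman J x.

Definition unique_bellman_solution_in (F : set (X -> \bar R))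
    (J : X -> \bar R) : Prop :=
  [/\ F J, bellman_solution J &
      forall J', F J' -> bellman_solution J' -> J' = J].

Definition bounded_cost : Prop :=
  ereal_sup [set (cost S z.1.1 z.1.2 z.2)%:E | z in [set: X * U * W]] < +oo.

End SSPDefs.

(* Main.v *)
Require Import Defs.
From mathcomp Require Import all_boot all_order all_algebra.
From mathcomp Require Import finmap lra.
From mathcomp Require Import all_classical all_reals all_analysis.
Import Order.TTheory GRing.Theory Num.Theory.
Import numFieldNormedType.Exports.
Set Implicit Arguments.
Unset Strict Implicit.
Unset Printing Implicit Defensive.
Local Open Scope classical_set_scope.
Local Open Scope ring_scope.
Local Open Scope ereal_scope.

(** Write T for the Bellman operator and T_delta for that of the
    delta-perturbed problem. The cost enters T only through its conditional mean
    given the state and the control (bellmanE); this mean lies in [0, M], where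
    M bounds the cost, so the problem is one of nonnegative stage costs.

    Jhat solves J = T J (Jhat_bellman). That T Jhat <= Jhat follows by splitting
    off the first stage of a proper policy, whose tail is proper at almost every
    next state. For the converse, zero-cost cycles are the obstacle: a policy
    that is near-optimal for Jhat stage by stage need not be proper. With a price
    delta > 0 on each step outside the destination, a policy of finite cost is
    automatically proper, so that Jhat <= Jhat_delta (Jhat_le_pert), and a policy
    whose k-th decision is greedy up to e / 2^(k+1) is near-optimal for
    Jhat_delta from all states at once (near_optimal). Applying a control u
    first and then such a policy gives
    Jhat(x) <= E(g + delta + Jhat_delta(f)) + e. As delta decreases to 0,
    Jhat_delta decreases to Jhat pointwise, and on the set where Jhat is finite
    it is at most (M + delta) c, with c the bound on the expected time that the
    uniformly proper policy spends outside the destination. Dominated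
    convergence (wsum_dominated) then gives Jhat <= T Jhat (Jhat_le_bellman).

    Value iteration from J_0 >= Jhat stays above Jhat, a fixed point of the
    monotone operator T. A policy proper at x costs over k stages at least
    J_k(x) minus b r_k, where b bounds J_0 where Jhat is finite
    (value_iteration_le); since r_k tends to 0, the limit is at most the cost of
    every proper policy, that is, Jhat. A solution above Jhat is a constant
    value iteration sequence, hence equals Jhat; and every nonnegative solution
    is at least Jstar, by the near-optimal policy for delta = 0
    (Jstar_le_solution), which settles the case Jhat = Jstar. *)

(** * Sums weighted by a nonnegative function *)

Lemma ereal_sup_image_bound (R : realType) T (f : T -> \bar R) (A : set T) :
  ereal_sup [set f a | a in A] < +oo ->
  exists2 b : R, (0 <= b)%R & forall a, A a -> f a <= b%:E.
Proof.
move=> supA; have le_sup a : A a -> f a <= ereal_sup [set f a | a in A].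
  by move=> Aa; apply: ereal_sup_ubound; exists a.
case: (ereal_sup _) supA le_sup => [r| |]// _ le_sup.
  exists `|r|%R => // a Aa; apply: le_trans (le_sup a Aa) _.
  by rewrite lee_fin ler_norm.
by exists 0%R => // a Aa; rewrite (le_trans (le_sup a Aa))// leNye.
Qed.

Section WeightedSums.
Variables (R : realType) (T : choiceType).
Implicit Types (p : T -> R) (f g h : T -> \bar R).

(** Scaling cannot increase the sum beyond the scaled sum, and the same fact
    for the inverse factor gives the other inequality. *)
Lemma esumZl (c : R) f : (0 <= c)%R -> (forall a, 0 <= f a) ->
  \esum_(a in [set: T]) (c%:E * f a) = c%:E * \esum_(a in [set: T]) f a.
Proof.
move=> c0 f0.
have le_scale (d : R) g : (0 <= d)%R -> (forall a, 0 <= g a) ->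
    \esum_(a in [set: T]) (d%:E * g a) <= d%:E * \esum_(a in [set: T]) g a.
  move=> d0 g0; apply: ge_ereal_sup => _ [F [finF _] <-].
  rewrite -ge0_mule_fsumr// lee_pmul// ?fsume_ge0//.
  by apply: ereal_sup_ubound; exists F.
have [->|cN0] := eqVneq c 0%R.
  by rewrite mul0e esum1// => a _; rewrite mul0e.
apply/eqP; rewrite eq_le le_scale//=.
have cp : (0 < c)%R by rewrite lt_neqAle eq_sym cN0.
have ci : (0 <= c^-1)%R by rewrite invr_ge0.
rewrite -(@lee_pmul2l _ c^-1%:E)//; last by rewrite lte_fin invr_gt0.
rewrite muleA -EFinM mulVf// mul1e.
apply: le_trans (le_scale _ _ ci (fun a => mule_ge0 _ (f0 a))) => //.
by apply: le_esum => a _; rewrite muleA -EFinM mulVf// mul1e.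
Qed.

Lemma esum_nneseries (F : nat -> T -> \bar R) : (forall k a, 0 <= F k a) ->
  \esum_(a in [set: T]) \sum_(0 <= k <oo) F k a
  = \sum_(0 <= k <oo) \esum_(a in [set: T]) F k a.
Proof.
move=> F0; rewrite nneseries_esumT; last by move=> k; exact: esum_ge0.
under eq_esum do rewrite nneseries_esumT//.
rewrite !esum_esum//.
rewrite (reindex_esum ([set: nat] `*`` fun=> [set: T]) _
  (fun z => (z.2, z.1)))//.
split=> //=; first by move=> [k a] [b l] _ _ [-> ->].
by move=> [a k] _ /=; exists (k, a).
Qed.

Definition wsum p h := \esum_(a in [set: T]) ((p a)%:E * h a).

Variables (p : T -> R) (p0 : forall a, (0 <= p a)%R).

Let pe0 a : 0 <= (p a)%:E. Proof. by rewrite lee_fin. Qed.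
Let ph0 h : (forall a, 0 <= h a) -> forall a, 0 <= (p a)%:E * h a.
Proof. by move=> h0 a; rewrite mule_ge0. Qed.

Lemma wsum_ge0 h : (forall a, 0 <= h a) -> 0 <= wsum p h.
Proof. by move=> h0; apply: esum_ge0 => a _; exact: ph0. Qed.

Lemma le_wsum g h : (forall a, (0 < p a)%R -> g a <= h a) ->
  wsum p g <= wsum p h.
Proof.
move=> gh; apply: le_esum => a _.
have := p0 a; rewrite le_eqVlt => /predU1P[<-|pa]; first by rewrite !mul0e.
by rewrite lee_pmul2l// gh.
Qed.

Lemma wsumD g h : (forall a, 0 <= g a) -> (forall a, 0 <= h a) ->
  wsum p (fun a => g a + h a) = wsum p g + wsum p h.
Proof.
move=> g0 h0; rewrite /wsum -esumD; do ?by move=> a _; exact: ph0.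
by apply: eq_esum => a _; rewrite ge0_muleDr.
Qed.

Lemma wsumZ (c : R) h : (0 <= c)%R -> (forall a, 0 <= h a) ->
  wsum p (fun a => c%:E * h a) = c%:E * wsum p h.
Proof.
move=> c0 h0; rewrite /wsum -esumZl//; last exact: ph0.
by apply: eq_esum => a _; rewrite muleCA.
Qed.

Lemma wsum_nneseries (F : nat -> T -> \bar R) : (forall k a, 0 <= F k a) ->
  wsum p (fun a => \sum_(0 <= k <oo) F k a) = \sum_(0 <= k <oo) wsum p (F k).
Proof.
move=> F0; rewrite /wsum -esum_nneseries; last by move=> k; exact: ph0.
by apply: eq_esum => a _; rewrite nneseriesZl.
Qed.

Lemma wsum_cst (c : R) : (0 <= c)%R -> \esum_(a in [set: T]) (p a)%:E = 1 ->
  wsum p (fun=> c%:E) = c%:E.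
Proof.
move=> c0 p1; rewrite -[RHS]mule1 -p1 -esumZl//.
by apply: eq_esum => a _; rewrite muleC.
Qed.

Lemma wsum_lty h : (forall a, 0 <= h a) -> wsum p h < +oo ->
  forall a, (0 < p a)%R -> h a < +oo.
Proof.
move=> h0 /(le_lt_trans _) + a pa => /(_ ((p a)%:E * h a)).
have -> : (p a)%:E * h a <= wsum p h.
  rewrite -(@esum_set1 _ _ a (fun a => (p a)%:E * h a)) ?ph0//.
  rewrite /wsum [leRHS](esumID [set a])//=; last by move=> b _; exact: ph0.
  by rewrite setTI leeDl// esum_ge0// => b _; exact: ph0.
move=> /(_ isT); apply: contraTT; rewrite -!leNgt !leye_eq => /eqP ->.
by rewrite gt0_muley.
Qed.

Lemma expect_wsum h : expect p h = wsum p h^\+ - wsum p h^\-.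
Proof. by []. Qed.

(** As +oo - +oo = -oo here, nonnegativity of the expectation forces both parts
    to be finite, not just their difference. *)
Lemma integrable_parts h : 0 <= expect p h < +oo ->
  wsum p h^\+ \is a fin_num /\ wsum p h^\- \is a fin_num.
Proof.
rewrite expect_wsum.
have : 0 <= wsum p h^\+ by apply: wsum_ge0 => a; rewrite funepos_ge0.
have : 0 <= wsum p h^\- by apply: wsum_ge0 => a; rewrite funeneg_ge0.
by case: (wsum p h^\-) => [m| |]; case: (wsum p h^\+) => [n| |]//= _ _ /andP[].
Qed.

(** The integrand may change sign only through g, so additivity follows by
    comparing positive and negative parts: the pointwise identity
    (g + h)^+ + g^- = (g + h)^- + g^+ + h holds even where h is +oo, and all the
    terms that have to be subtracted have finite sums because
    (g + h)^- <= g^-. *)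
Lemma expectD (g : T -> R) h : (forall a, 0 <= h a) ->
    0 <= expect p (fun a => (g a)%:E) < +oo ->
  expect p (fun a => (g a)%:E + h a)
  = expect p (fun a => (g a)%:E) + wsum p h.
Proof.
move=> h0 /integrable_parts; rewrite !expect_wsum.
set G := fun a => (g a)%:E; set S := fun a => _ + _ => -[Gp Gm].
have pos f : forall a, 0 <= f^\+ a by move=> a; rewrite funepos_ge0.
have neg f : forall a, 0 <= f^\- a by move=> a; rewrite funeneg_ge0.
have : wsum p S^\+ + wsum p G^\- = wsum p S^\- + (wsum p G^\+ + wsum p h).
  rewrite -!wsumD//; last by move=> a; rewrite adde_ge0.
  congr wsum; apply/funext => a; rewrite !funeposE !funenegE /S /G.
  have := h0 a; case: (h a) => [r| |]// r0; last first.
    rewrite addey// maxye maxNye add0e addey ?addye//.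
    + by case: (leP (- (g a)%:E) 0).
    + by case: (leP (g a)%:E 0).
  rewrite -EFinD -!EFinN -!EFin_max -!EFinD; congr EFin.
  rewrite lee_fin in r0.
  by case: (leP (g a + r)%R 0%R); case: (leP (- g a)%R 0%R);
    case: (leP (- (g a + r))%R 0%R); case: (leP (g a) 0%R) => *; lra.
have Sm : wsum p S^\- \is a fin_num.
  rewrite ge0_fin_numE ?wsum_ge0//.
  apply: le_lt_trans (ltry (fine (wsum p G^\-))).
  rewrite fineK//; apply: le_wsum => a _; rewrite !funenegE /S /G.
  have := h0 a; case: (h a) => [r| |]// r0; last first.
    by rewrite addey//= maxNye; case: (leP (- (g a)%:E) 0) => // /ltW.
  rewrite -EFinD -!EFinN -!EFin_max lee_fin; rewrite lee_fin in r0.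
  by case: (leP (- g a)%R 0%R); case: (leP (- (g a + r))%R 0%R) => *; lra.
have h_ge0 : 0 <= wsum p h by exact: wsum_ge0.
have : 0 <= wsum p S^\+ by exact: wsum_ge0.
move: Sm Gp Gm h_ge0.
case: (wsum p S^\-) => [b| |]//; case: (wsum p G^\+) => [c| |]//.
case: (wsum p G^\-) => [d| |]//; case: (wsum p h) => [e| |]//;
  case: (wsum p S^\+) => [s| |]//= _ _ _ _ _ [] E.
by congr EFin; lra.
Qed.

(** Upper half of the dominated convergence theorem for a probability mass
    function. A finite set A carries all but e / (2 D) of the mass, where
    D > 0 bounds the functions; off A they contribute at most e / 2, and since A
    is finite, one index brings them below h + e / 2 on all of A. *)
Lemma wsum_dominated (F : nat -> T -> \bar R) h (C : R) :
    \esum_(a in [set: T]) (p a)%:E = 1 ->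
    (forall a, 0 <= h a) ->
    (forall n a, (0 < p a)%R -> F n a <= C%:E) ->
    (forall a, (0 < p a)%R -> forall e : R, (0 < e)%R ->
       exists N, forall n, (N <= n)%N -> F n a <= h a + e%:E) ->
  forall e : R, (0 < e)%R -> exists n, wsum p (F n) <= wsum p h + e%:E.
Proof.
move=> p1 h0 FC Fh e e0.
have e20 : (0 < e / 2)%R by rewrite divr_gt0.
pose D := (`|C| + 1)%R.
have D0 : (0 < D)%R by rewrite ltr_pwDr.
have [_ [A [finA _] <-] pA] : exists2 y,
    [set \sum_(x \in A) (p x)%:E | A in fsets [set: T]] y &
    (1 - e / 2 / D)%:E < y.
  apply: ereal_sup_gt; rewrite -/(esum _ _) p1.
  by rewrite lte_fin ltrBlDr ltrDl !divr_gt0.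
pose out a : \bar R := if a \in A then 0 else 1.
pose ins a : \bar R := if a \in A then 1 else 0.
have out0 a : 0 <= out a by rewrite /out; case: ifP.
have ins0 a : 0 <= ins a by rewrite /ins; case: ifP.
have insA : \sum_(x \in A) (p x)%:E <= wsum p ins.
  apply: esum_ge; exists A => //; apply: lee_fsum => // a Aa.
  by rewrite /ins mem_set// mule1.
have outA : wsum p out <= (e / 2 / D)%:E.
  have : wsum p out + wsum p ins = 1.
    rewrite -wsumD// -[RHS](@wsum_cst 1)//; congr wsum; apply/funext => a.
    by rewrite /out /ins; case: ifP; rewrite ?adde0 ?add0e.
  move: (lt_le_trans pA insA) (wsum_ge0 out0).
  case: (wsum p out) => [q| |]//; case: (wsum p ins) => [i| |]//.
  by rewrite !lee_fin lte_fin => ilb _ [oi1]; lra.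
have [N FN] : exists N, forall a, A a -> (0 < p a)%R ->
    F N a <= h a + (e / 2)%:E.
  have /choice[N HN] a : exists N, (0 < p a)%R ->
      forall n, (N <= n)%N -> F n a <= h a + (e / 2)%:E.
    have [pa|_] := ltP 0%R (p a); last by exists 0%N.
    by have [N HN] := Fh a pa _ e20; exists N.
  exists (\max_(a <- fset_set A) N a)%N => a Aa pa; apply: HN => //.
  by apply: leq_bigmax_seq => //; rewrite in_fset_set// inE.
exists N; apply: (@le_trans _ _
  (wsum p (fun a => h a + (e / 2)%:E + D%:E * out a))).
  apply: le_wsum => a pa; rewrite /out; case: ifPn => [|_].
    by rewrite inE => Aa; rewrite mule0 adde0 FN.
  rewrite mule1 (le_trans (FC _ _ pa))// -[leLHS]add0e leeD//.
    by rewrite adde_ge0// lee_fin ltW.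
  by rewrite lee_fin (le_trans (ler_norm _))// lerDl.
have e2 : 0 <= (e / 2)%:E by rewrite lee_fin ltW.
rewrite !wsumD ?wsumZ ?wsum_cst//; do ?by [exact: ltW|
  move=> a; rewrite ?adde_ge0// ?mule_ge0// lee_fin ltW].
have -> : e%:E = (e / 2)%:E + (e / 2)%:E by rewrite -EFinD -splitr.
rewrite addeA leeD2l//.
apply: (@le_trans _ _ (D%:E * (e / 2 / D)%:E)).
  by rewrite lee_pmul2l// lte_fin.
by rewrite -EFinM mulrCA mulfV ?gt_eqF// mulr1.
Qed.

End WeightedSums.

(** * Recursions along a trajectory *)

Local Notation tail := Defs.shift.

Section Recursions.
Variables (R : realType) (X U : Type) (W : countType) (S : ssp R X U W).
Implicit Types (pi : nat -> X -> U) (x : X) (u : U) (V : X -> \bar R).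

Definition mean_next x u V := wsum (prob S x u) (V \o dyn S x u).

Definition mean_cost x u := expect (prob S x u) (fun w => (cost S x u w)%:E).

Lemma policies_shift pi : policies S pi -> policies S (tail pi).
Proof. by move=> piP k x; exact: piP. Qed.

Let p0 x u : feasible S x u -> forall w, (0 <= prob S x u w)%R.
Proof. by move=> xu w; apply: prob_ge0. Qed.

Lemma mean_ge0 x u V : feasible S x u -> (forall y, 0 <= V y) ->
  0 <= mean_next x u V.
Proof. by move=> xu V0; apply: wsum_ge0 => [|w]; [exact: p0|exact: V0]. Qed.

Lemma le_mean x u V1 V2 : feasible S x u ->
  (forall w, (0 < prob S x u w)%R -> V1 (dyn S x u w) <= V2 (dyn S x u w)) ->
  mean_next x u V1 <= mean_next x u V2.
Proof. by move=> xu V12; apply: le_wsum => //; exact: p0. Qed.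

Lemma meanD x u V1 V2 : feasible S x u ->
  (forall y, 0 <= V1 y) -> (forall y, 0 <= V2 y) ->
  mean_next x u (fun y => V1 y + V2 y) = mean_next x u V1 + mean_next x u V2.
Proof.
move=> xu V10 V20; rewrite /mean_next -(wsumD (p0 xu)) => // w.
  exact: V10.
exact: V20.
Qed.

Lemma meanZ x u (c : R) V : feasible S x u -> (0 <= c)%R ->
    (forall y, 0 <= V y) ->
  mean_next x u (fun y => c%:E * V y) = c%:E * mean_next x u V.
Proof.
by move=> xu c0 V0; rewrite /mean_next -(wsumZ (p0 xu)) => // w; exact: V0.
Qed.

Lemma mean_cst x u (c : R) : feasible S x u -> (0 <= c)%R ->
  mean_next x u (fun=> c%:E) = c%:E.
Proof.
by move=> xu c0; exact: (wsum_cst (p0 xu) c0 (prob_sum1 xu)).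
Qed.

Lemma mean_nneseries x u (F : nat -> X -> \bar R) : feasible S x u ->
  (forall k y, 0 <= F k y) ->
  mean_next x u (fun y => \sum_(0 <= k <oo) F k y)
  = \sum_(0 <= k <oo) mean_next x u (F k).
Proof.
move=> xu F0; rewrite /mean_next -(wsum_nneseries (p0 xu)) => // k w.
exact: F0.
Qed.

Lemma mean_lty x u V : feasible S x u -> (forall y, 0 <= V y) ->
  mean_next x u V < +oo ->
  forall w, (0 < prob S x u w)%R -> V (dyn S x u w) < +oo.
Proof.
by move=> xu V0; apply: (wsum_lty (p0 xu)) => w; exact: V0.
Qed.

Lemma mean_cost_fin x u : feasible S x u -> 0 <= mean_cost x u < +oo.
Proof. exact: cost_expect. Qed.

(** Absorption; the value +oo needs a separate argument, since 0 * +oo = 0 and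
    one has to know that some disturbance has positive probability. *)
Lemma mean_dest u V : feasible S (dest S) u -> (forall y, 0 <= V y) ->
  mean_next (dest S) u V = V (dest S).
Proof.
move=> du V0; rewrite /mean_next.
have -> : V \o dyn S (dest S) u = fun=> V (dest S).
  by apply/funext => w /=; rewrite dyn_dest.
have := V0 (dest S); case: (V (dest S)) => [r| |]// r0.
  by rewrite lee_fin in r0; exact: (wsum_cst (p0 du) r0 (prob_sum1 du)).
apply/eqP; rewrite -leye_eq leNgt; apply/negP => /(wsum_lty (p0 du)) lty.
have pn w : prob S (dest S) u w = 0%R.
  apply/eqP; rewrite eq_le (p0 du) andbT leNgt; apply/negP => pw.
  by have := lty (fun=> r0) w pw.
have := prob_sum1 du; rewrite esum1 => [/eqP|w _]; last by rewrite pn.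
by rewrite eqe eq_sym oner_eq0.
Qed.

(** The Bellman operator depends on the cost only through its conditional mean,
    which is nonnegative although the cost itself need not be. *)
Lemma bellmanE V x : (forall y, 0 <= V y) -> bellman S V x =
  ereal_inf [set mean_cost x u + mean_next x u V | u in feasible S x].
Proof.
move=> V0; congr ereal_inf; apply: eq_imagel => u xu.
by rewrite (expectD (p0 xu))//; exact: cost_expect.
Qed.

Lemma traj_prob_ge0 pi x ws : policies S pi -> (0 <= traj_prob S pi x ws)%R.
Proof.
elim: ws pi x => [|w ws IH] pi x piP //=.
rewrite mulr_ge0 ?IH//; [exact: (prob_ge0 (piP _ _))|exact: policies_shift].
Qed.

Definition traj_sum pi x n (h : n.-tuple W -> \bar R) :=
  wsum (fun ws : n.-tuple W => traj_prob S pi x ws) h.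

Lemma traj_sum0 pi x (h : 0.-tuple W -> \bar R) : 0 <= h [tuple] ->
  traj_sum pi x h = h [tuple].
Proof.
move=> h0; rewrite /traj_sum /wsum (_ : [set: 0.-tuple W] = [set [tuple]]).
  by rewrite esum_set1 /= mul1e.
by apply/seteqP; split=> // ws _; rewrite /= tuple0.
Qed.

(** Conditioning on the first disturbance: a word of length n.+1 is a letter
    followed by a word of length n. *)
Lemma traj_sumS pi x n (h : n.+1.-tuple W -> \bar R) : policies S pi ->
  (forall ws, 0 <= h ws) ->
  traj_sum pi x h = wsum (prob S x (pi 0%N x)) (fun w =>
    traj_sum (tail pi) (dyn S x (pi 0%N x) w)
      (fun ws : n.-tuple W => h (cons_tuple w ws))).
Proof.
move=> piP h0; set u := pi 0%N x.
have pr0 := p0 (piP 0%N x).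
have t0 y ws : (0 <= traj_prob S (tail pi) y ws)%R.
  by apply: traj_prob_ge0; exact: policies_shift.
transitivity (\esum_(w in [set: W]) \esum_(ws in [set: n.-tuple W])
    ((prob S x u w)%:E *
     ((traj_prob S (tail pi) (dyn S x u w) ws)%:E * h (cons_tuple w ws)))).
  rewrite esum_esum; last by move=> w ws _ _; rewrite !mule_ge0// lee_fin.
  rewrite /traj_sum /wsum (reindex_esum ([set: W] `*`` fun=> [set: n.-tuple W])
    _ (fun z => cons_tuple z.1 z.2)).
    by apply: eq_esum => -[w ws] _ /=; rewrite EFinM muleA.
  split=> //=.
  - by move=> [w ws] [w' ws'] _ _ /= /(congr1 val) /= [-> /val_inj ->].
  - move=> ws _; exists (thead ws, behead_tuple ws) => //=.
    by rewrite [RHS]tuple_eta.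
apply: eq_esum => w _; rewrite esumZl//.
by move=> ws; rewrite mule_ge0// lee_fin.
Qed.

(** The expectation of phi (g) at stage k. It is used for phi the positive
    and the negative part, which are nonnegative and so can be handled by
    unconditional summation. *)
Definition traj_stage (phi : R -> R) pi x k :=
  traj_sum pi x (fun ws : k.+1.-tuple W =>
    let xk := state S pi x (take k ws) in
    (phi (cost S xk (pi k xk) (tnth ws ord_max)))%:E).

Lemma traj_stage0 (phi : R -> R) pi x : policies S pi ->
    (forall r, 0 <= phi r)%R ->
  traj_stage phi pi x 0 =
  wsum (prob S x (pi 0%N x)) (fun w => (phi (cost S x (pi 0%N x) w))%:E).
Proof.
move=> piP phi0; rewrite /traj_stage traj_sumS//; last first.
  by move=> ws; rewrite lee_fin.
congr wsum; apply/funext => w.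
by rewrite traj_sum0 ?lee_fin//= (tnth_nth w).
Qed.

Lemma traj_stageS (phi : R -> R) pi x k : policies S pi ->
    (forall r, 0 <= phi r)%R ->
  traj_stage phi pi x k.+1 =
  mean_next x (pi 0%N x) (fun y => traj_stage phi (tail pi) y k).
Proof.
move=> piP phi0; rewrite /traj_stage traj_sumS//; last first.
  by move=> ws; rewrite lee_fin.
rewrite /mean_next; congr wsum; apply/funext => w /=.
congr (traj_sum _ _ _); apply/funext => ws /=.
by rewrite !(tnth_nth w).
Qed.

Lemma traj_stage_ge0 (phi : R -> R) pi x k : policies S pi ->
    (forall r, 0 <= phi r)%R -> 0 <= traj_stage phi pi x k.
Proof.
move=> piP phi0; apply: wsum_ge0 => ws; first exact: traj_prob_ge0.
by rewrite lee_fin.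
Qed.

Lemma traj_stage_le (phi : R -> R) (M : R) pi x k :
    (forall r, 0 <= phi r)%R -> (0 <= M)%R ->
    (forall x u, feasible S x u ->
       wsum (prob S x u) (fun w => (phi (cost S x u w))%:E) <= M%:E) ->
  policies S pi -> traj_stage phi pi x k <= M%:E.
Proof.
move=> phi0 M0 phiM; elim: k pi x => [|k IH] pi x piP.
  by rewrite traj_stage0// phiM.
rewrite traj_stageS// -(@mean_cst x (pi 0%N x) M)//.
by apply: le_mean => // w _; rewrite IH//; exact: policies_shift.
Qed.

Let pos (r : R) : R := Num.max r 0%R.
Let neg (r : R) : R := Num.max (- r)%R 0%R.

Lemma stage_costE pi x k : policies S pi ->
  stage_cost S pi x k = traj_stage pos pi x k - traj_stage neg pi x k.
Proof.
move=> piP; rewrite /stage_cost /traj_expect expect_wsum; congr (_ - _);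
  congr wsum; apply/funext => ws;
  by rewrite ?funeposE ?funenegE /pos /neg EFin_max.
Qed.

Lemma stage_cost0 pi x : policies S pi ->
  stage_cost S pi x 0 = mean_cost x (pi 0%N x).
Proof.
move=> piP; rewrite stage_costE// !traj_stage0//;
  try by move=> r; rewrite /pos /neg le_max lexx orbT.
rewrite /mean_cost expect_wsum; congr (_ - _);
  congr wsum; apply/funext => w;
  by rewrite ?funeposE ?funenegE /pos /neg EFin_max.
Qed.

Section Bounded.
Variables (M : R) (M0 : (0 <= M)%R).
Variable costM : forall x u w, (cost S x u w <= M)%R.

Let pos0 r : (0 <= pos r)%R. Proof. by rewrite /pos /neg le_max lexx orbT. Qed.
Let neg0 r : (0 <= neg r)%R. Proof. by rewrite /pos /neg le_max lexx orbT. Qed.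

Let wpos x u : feasible S x u ->
  wsum (prob S x u) (fun w => (pos (cost S x u w))%:E) <= M%:E.
Proof.
move=> xu; rewrite -(@mean_cst x u M)//; apply: (le_wsum (p0 xu)) => w _ /=.
by rewrite lee_fin /pos ge_max costM.
Qed.

(** The negative part of the cost is not bounded pointwise, but its conditional
    mean is at most that of the positive part, as the cost has a nonnegative
    mean. Hence only finite quantities are ever subtracted. *)
Let wneg x u : feasible S x u ->
  wsum (prob S x u) (fun w => (neg (cost S x u w))%:E) <= M%:E.
Proof.
move=> xu; apply: le_trans (wpos xu).
have /andP[] := mean_cost_fin xu; rewrite /mean_cost expect_wsum.
have -> : (fun w => (cost S x u w)%:E)^\+ = fun w => (pos (cost S x u w))%:E.
  by apply/funext => w; rewrite funeposE /pos EFin_max.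
have -> : (fun w => (cost S x u w)%:E)^\- = fun w => (neg (cost S x u w))%:E.
  by apply/funext => w; rewrite funenegE /pos /neg EFin_max.
move=> + _; have := wpos xu.
set A := wsum _ (fun w => (pos _)%:E); set B := wsum _ _.
case: A => [a| |]//; case: B => [b| |]//= _.
  by rewrite -EFinD !lee_fin subr_ge0.
by rewrite leNye.
Qed.

Lemma mean_cost_ge0 x u : feasible S x u -> 0 <= mean_cost x u.
Proof. by move=> /mean_cost_fin/andP[]. Qed.

Lemma mean_cost_le x u : feasible S x u -> mean_cost x u <= M%:E.
Proof.
move=> xu; rewrite /mean_cost expect_wsum.
apply: (@le_trans _ _ (wsum (prob S x u) (fun w => (cost S x u w)%:E)^\+)).
  by rewrite -[leRHS]sube0 leeB// wsum_ge0//; exact: p0.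
apply: le_trans (wpos xu); apply: (le_wsum (p0 xu)) => w _.
by rewrite funeposE /pos EFin_max.
Qed.

Let meanB x u V1 V2 : feasible S x u -> (forall y, 0 <= V2 y) ->
  (forall y, V2 y <= M%:E) -> (forall y, 0 <= V1 y - V2 y) ->
  mean_next x u (fun y => V1 y - V2 y) = mean_next x u V1 - mean_next x u V2.
Proof.
move=> xu V20 V2M V12.
have fin2 y : V2 y \is a fin_num.
  by rewrite ge0_fin_numE// (le_lt_trans (V2M y)) ?ltry.
have finm : mean_next x u V2 \is a fin_num.
  rewrite ge0_fin_numE ?mean_ge0// (@le_lt_trans _ _ M%:E) ?ltry//.
  by rewrite -(@mean_cst x u M)//; apply: le_mean.
have -> : mean_next x u V1 =
    mean_next x u (fun y => V1 y - V2 y) + mean_next x u V2.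
  by rewrite -meanD//; congr mean_next; apply/funext => y; rewrite subeK.
by rewrite addeK.
Qed.

(** Nonnegativity of the later stage costs is what allows the difference of the
    two parts to be averaged; it is proved by induction together with this
    recursion. *)
Let stage_cost_step pi x k : policies S pi ->
  (forall y, 0 <= stage_cost S (tail pi) y k) ->
  stage_cost S pi x k.+1 =
  mean_next x (pi 0%N x) (fun y => stage_cost S (tail pi) y k).
Proof.
move=> piP ge0; have tP := policies_shift piP.
have -> : (fun y => stage_cost S (tail pi) y k) =
    fun y => traj_stage pos (tail pi) y k - traj_stage neg (tail pi) y k.
  by apply/funext => y; rewrite stage_costE.
rewrite stage_costE// !traj_stageS// meanB// => y; last by rewrite -stage_costE.
  exact: traj_stage_ge0.
exact: traj_stage_le.
Qed.

Lemma stage_cost_ge0 pi x k : policies S pi -> 0 <= stage_cost S pi x k.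
Proof.
elim: k pi x => [|k IH] pi x piP.
  by rewrite stage_cost0// mean_cost_ge0.
have tP := policies_shift piP.
by rewrite stage_cost_step ?mean_ge0// => y; exact: IH.
Qed.

Lemma stage_costS pi x k : policies S pi -> stage_cost S pi x k.+1 =
  mean_next x (pi 0%N x) (fun y => stage_cost S (tail pi) y k).
Proof.
move=> piP; rewrite stage_cost_step// => y.
by apply: stage_cost_ge0; exact: policies_shift.
Qed.

End Bounded.

(** Its expectation after k steps is r_k, which thereby obeys the same recursion
    as the stage costs. *)
Definition off_dest x : \bar R := if asbool (x = dest S) then 0 else 1.

Lemma off_dest_ge0 x : 0 <= off_dest x.
Proof. by rewrite /off_dest; case: ifP. Qed.

Lemma notdest_probE pi x k : notdest_prob S pi x k =
  traj_sum pi x (fun ws : k.-tuple W => off_dest (state S pi x ws)).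
Proof.
rewrite /notdest_prob esum_mkcond; apply: eq_esum => ws _.
rewrite /off_dest; case: ifPn; rewrite ?inE ?notin_setE/=; case: asboolP => //.
  by rewrite mule1.
by rewrite mule0.
Qed.

Lemma notdest_prob_ge0 pi x k : policies S pi -> 0 <= notdest_prob S pi x k.
Proof.
move=> piP; rewrite notdest_probE; apply: wsum_ge0 => ws.
  exact: traj_prob_ge0.
exact: off_dest_ge0.
Qed.

Lemma notdest_prob0 pi x : notdest_prob S pi x 0 = off_dest x.
Proof. by rewrite notdest_probE traj_sum0//= off_dest_ge0. Qed.

Lemma notdest_probS pi x k : policies S pi -> notdest_prob S pi x k.+1 =
  mean_next x (pi 0%N x) (fun y => notdest_prob S (tail pi) y k).
Proof.
move=> piP; rewrite notdest_probE traj_sumS//; last first.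
  by move=> ws; exact: off_dest_ge0.
by rewrite /mean_next; congr wsum; apply/funext => w /=; rewrite notdest_probE.
Qed.

End Recursions.

(** * Policies and their costs *)

Section DynamicProgramming.
Variables (R : realType) (X U : Type) (W : countType) (S : ssp R X U W).
Implicit Types (pi : nat -> X -> U) (x : X) (u : U) (V : X -> \bar R).
Variables (M : R) (M0 : (0 <= M)%R).
Variable costM : forall x u w, (cost S x u w <= M)%R.

Let sc0 := stage_cost_ge0 M0 costM.

Definition pert_cost (d : R) x u := mean_cost S x u + d%:E * off_dest S x.

Definition pert_stage (d : R) pi x k :=
  stage_cost S pi x k + d%:E * notdest_prob S pi x k.

Definition pert_bellman (d : R) V x :=
  ereal_inf [set pert_cost d x u + mean_next S x u V | u in feasible S x].

Lemma pert_stage_ge0 d pi x k : (0 <= d)%R -> policies S pi ->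
  0 <= pert_stage d pi x k.
Proof. by move=> d0 piP; rewrite adde_ge0 ?sc0// mule_ge0// notdest_prob_ge0. Qed.

Lemma pert_stage0 d pi x : policies S pi ->
  pert_stage d pi x 0 = pert_cost d x (pi 0%N x).
Proof. by move=> piP; rewrite /pert_stage stage_cost0// notdest_prob0. Qed.

Lemma pert_stageS d pi x k : (0 <= d)%R -> policies S pi ->
  pert_stage d pi x k.+1 =
  mean_next S x (pi 0%N x) (fun y => pert_stage d (tail pi) y k).
Proof.
move=> d0 piP; have tP := policies_shift piP.
rewrite /pert_stage (stage_costS M0 costM)// notdest_probS//.
rewrite meanD//; last 2 first.
- by move=> y; exact: sc0.
- by move=> y; rewrite mule_ge0// notdest_prob_ge0.
by rewrite meanZ// => y; exact: notdest_prob_ge0.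
Qed.

Lemma Jpol_pertE d pi x : (0 <= d)%R -> policies S pi ->
  Jpol_pert S d pi x = \sum_(0 <= k <oo) pert_stage d pi x k.
Proof.
move=> d0 piP; rewrite nneseriesD//.
- by rewrite nneseriesZl// => k _; exact: notdest_prob_ge0.
- by move=> k _ _; exact: sc0.
- by move=> k _ _; rewrite mule_ge0// notdest_prob_ge0.
Qed.

Lemma Jpol_pert_ge0 d pi x : (0 <= d)%R -> policies S pi ->
  0 <= Jpol_pert S d pi x.
Proof.
move=> d0 piP; rewrite Jpol_pertE// nneseries_ge0// => k _ _.
exact: pert_stage_ge0.
Qed.

(** The cost of a policy splits into the first stage and the cost of its tail;
    for nonnegative stage costs this is an exchange of sums. *)
Lemma Jpol_pert_rec d pi x : (0 <= d)%R -> policies S pi ->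
  Jpol_pert S d pi x =
  pert_cost d x (pi 0%N x) + mean_next S x (pi 0%N x) (Jpol_pert S d (tail pi)).
Proof.
move=> d0 piP; have tP := policies_shift piP.
rewrite Jpol_pertE// nneseries_recl//; last by move=> k _; exact: pert_stage_ge0.
rewrite pert_stage0//; congr (_ + _).
rewrite -(nneseries_addn (f := pert_stage d pi x) 1); last first.
  by move=> k; exact: pert_stage_ge0.
under eq_eseriesr do rewrite addn1 pert_stageS//.
rewrite -mean_nneseries//; last by move=> k y; exact: pert_stage_ge0.
by congr mean_next; apply/funext => y; rewrite Jpol_pertE.
Qed.

Lemma Jpol_pert0 pi : Jpol_pert S 0 pi = Jpol S pi.
Proof. by apply/funext => x; rewrite /Jpol_pert mul0e adde0. Qed.

Lemma pert_cost0 x u : pert_cost 0 x u = mean_cost S x u.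
Proof. by rewrite /pert_cost mul0e adde0. Qed.

Lemma Jpol_ge0 pi x : policies S pi -> 0 <= Jpol S pi x.
Proof. by move=> piP; rewrite -Jpol_pert0 Jpol_pert_ge0. Qed.

Lemma Jpol_rec pi x : policies S pi -> Jpol S pi x =
  mean_cost S x (pi 0%N x) + mean_next S x (pi 0%N x) (Jpol S (tail pi)).
Proof.
move=> piP; rewrite -(Jpol_pert0 pi) Jpol_pert_rec// pert_cost0.
by rewrite Jpol_pert0.
Qed.

Lemma notdest_sum_ge0 pi x : policies S pi -> 0 <= notdest_sum S pi x.
Proof. by move=> piP; apply: nneseries_ge0 => k _ _; exact: notdest_prob_ge0. Qed.

Lemma notdest_sum_rec pi x : policies S pi -> notdest_sum S pi x =
  off_dest S x + mean_next S x (pi 0%N x) (notdest_sum S (tail pi)).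
Proof.
move=> piP; have tP := policies_shift piP.
rewrite /notdest_sum nneseries_recl//; last first.
  by move=> k _; exact: notdest_prob_ge0.
rewrite notdest_prob0; congr (_ + _).
rewrite -(nneseries_addn (f := notdest_prob S pi x) 1); last first.
  by move=> k; exact: notdest_prob_ge0.
under eq_eseriesr do rewrite addn1 notdest_probS//.
by rewrite -mean_nneseries// => k y; exact: notdest_prob_ge0.
Qed.

(** A finite mean forces finiteness at each successor of positive
    probability. *)
Lemma proper_at_tail pi x w : proper_at S x pi ->
  (0 < prob S x (pi 0%N x) w)%R ->
  proper_at S (dyn S x (pi 0%N x) w) (tail pi).
Proof.
move=> [piP Jfin nfin] pw; have tP := policies_shift piP.
split => //.
- apply: (mean_lty (piP 0%N x) _ _ pw) => [y|]; first exact: Jpol_ge0.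
  apply: le_lt_trans Jfin; rewrite [leRHS]Jpol_rec// leeDr//.
  exact: mean_cost_ge0.
- apply: (mean_lty (piP 0%N x) _ _ pw) => [y|]; first exact: notdest_sum_ge0.
  apply: le_lt_trans nfin; rewrite [leRHS]notdest_sum_rec// leeDr//.
  exact: off_dest_ge0.
Qed.

Lemma mean_sum x u n (F : nat -> X -> \bar R) : feasible S x u ->
    (forall k y, 0 <= F k y) ->
  mean_next S x u (fun y => \sum_(0 <= k < n) F k y)
  = \sum_(0 <= k < n) mean_next S x u (F k).
Proof.
move=> xu F0; elim: n => [|n IH].
  rewrite big_nil -[RHS](mean_cst xu (lexx 0%R)); congr mean_next.
  by apply/funext => y; rewrite big_nil.
rewrite big_nat_recr//= -IH -meanD//; last by move=> y; exact: sume_ge0.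
by congr mean_next; apply/funext => y; rewrite big_nat_recr.
Qed.

(** A policy whose stage-k decision is greedy for V up to e / 2^(k+1) loses at
    most e in total. Its tail satisfies the same hypothesis with e / 2 in place
    of e, so that the induction on the horizon never has to sum the errors.
    Replacing the terminal value 0 by V >= 0 only increases the cost. *)
Lemma greedy_partial_sum d V n pi (e : R) : (0 <= d)%R -> (forall x, 0 <= V x) ->
    policies S pi -> (0 <= e)%R ->
    (forall k x, pert_cost d x (pi k x) + mean_next S x (pi k x) V
       <= V x + (e / 2 ^+ k.+1)%:E) ->
  forall x, \sum_(0 <= k < n) pert_stage d pi x k <= V x + e%:E.
Proof.
move=> d0 V0; elim: n pi e => [|n IH] pi e piP e0 greedy x.
  by rewrite big_nil adde_ge0// lee_fin.
have tP := policies_shift piP; have e20 : (0 <= e / 2)%R by rewrite divr_ge0.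
rewrite big_nat_recl//= pert_stage0//.
under eq_bigr do rewrite pert_stageS//.
rewrite -mean_sum//; last by move=> k y; exact: pert_stage_ge0.
have tail_greedy y : \sum_(0 <= k < n) pert_stage d (tail pi) y k
    <= V y + (e / 2)%:E.
  apply: IH => // k z; apply: le_trans (greedy k.+1 z) _.
  by rewrite exprS invfM mulrA.
apply: (@le_trans _ _ (pert_cost d x (pi 0%N x)
    + mean_next S x (pi 0%N x) (fun y => V y + (e / 2)%:E))).
  by rewrite leeD2l// le_mean.
rewrite meanD// mean_cst// addeA.
have -> : e%:E = (e / 2)%:E + (e / 2)%:E by rewrite -EFinD -splitr.
by rewrite addeA leeD2r//; have := greedy 0%N x; rewrite expr1.
Qed.

(** A single Markov policy is e-optimal against V at all initial states
    simultaneously. This uniformity is what makes it possible to prepend a first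
    control: choosing a good policy separately for each successor state would
    not give a policy that depends on the stage and the current state only. *)
Lemma near_optimal d V (e : R) : (0 <= d)%R -> (forall x, 0 <= V x) ->
    (forall x, pert_bellman d V x <= V x) -> (0 < e)%R ->
  exists2 pi, policies S pi & forall x, Jpol_pert S d pi x <= V x + e%:E.
Proof.
move=> d0 V0 VT e0.
have greedy k x : exists u, feasible S x u /\
    pert_cost d x u + mean_next S x u V <= V x + (e / 2 ^+ k.+1)%:E.
  have ek0 : (0 < e / 2 ^+ k.+1)%R by rewrite divr_gt0// exprn_gt0.
  have [Vfin|] := boolP (V x \is a fin_num); last first.
    rewrite ge0_fin_numE// -leNgt leye_eq => /eqP ->.
    by have [u xu] := feasible_nonempty S x; exists u; rewrite addye ?leey.
  have /ereal_inf_lt[_ [u xu <-] /ltW uV] :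
      pert_bellman d V x < V x + (e / 2 ^+ k.+1)%:E.
    by apply: le_lt_trans (VT x) _; rewrite lteDl// lte_fin.
  by exists u.
have /choice[pi piE] k : exists mu : X -> U, forall x, feasible S x (mu x) /\
    pert_cost d x (mu x) + mean_next S x (mu x) V <= V x + (e / 2 ^+ k.+1)%:E.
  by have /choice[mu muE] := greedy k; exists mu.
have piP : policies S pi by move=> k x; have [] := piE k x.
exists pi => // x; rewrite Jpol_pertE//; apply: lime_le.
  by apply: is_cvg_nneseries => k _ _; exact: pert_stage_ge0.
apply: nearW => n; apply: greedy_partial_sum => //; first exact: ltW.
by move=> k y; have [] := piE k y.
Qed.

Lemma Jhat_pert_ge0 d x : (0 <= d)%R -> 0 <= Jhat_pert S d x.
Proof.
by move=> d0; apply: le_ereal_inf_tmp => _ [pi piP <-]; exact: Jpol_pert_ge0.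
Qed.

Lemma Jhat_pert_bellman d x : (0 <= d)%R ->
  pert_bellman d (Jhat_pert S d) x <= Jhat_pert S d x.
Proof.
move=> d0; apply: le_ereal_inf_tmp => _ [pi piP <-].
apply: ge_ereal_inf; exists (pert_cost d x (pi 0%N x)
    + mean_next S x (pi 0%N x) (Jhat_pert S d)).
  by exists (pi 0%N x).
rewrite Jpol_pert_rec// leeD2l// le_mean// => w _.
by apply: ereal_inf_lbound; exists (tail pi) => //; exact: policies_shift.
Qed.

Lemma Jhat_ge0 x : 0 <= Jhat S x.
Proof. by apply: le_ereal_inf_tmp => _ [pi [piP _ _] <-]; exact: Jpol_ge0. Qed.

(** A positive price on the time spent outside the destination makes every
    policy of finite perturbed cost proper. *)
Lemma Jhat_le_pert d x : (0 < d)%R -> Jhat S x <= Jhat_pert S d x.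
Proof.
move=> d0; apply: le_ereal_inf_tmp => _ [pi piP <-].
have dn0 : 0 <= d%:E * notdest_sum S pi x.
  by rewrite mule_ge0 ?notdest_sum_ge0// lee_fin ltW.
have [Jfin|] := ltP (Jpol_pert S d pi x) +oo; last first.
  by rewrite leye_eq => /eqP ->; rewrite leey.
apply: (@le_trans _ _ (Jpol S pi x)); last by rewrite leeDl.
apply: ereal_inf_lbound; exists pi => //; split=> //.
  by apply: le_lt_trans Jfin; rewrite leeDl.
have : d%:E * notdest_sum S pi x < +oo.
  by apply: le_lt_trans Jfin; rewrite leeDr// Jpol_ge0.
apply: contraTT; rewrite -!leNgt !leye_eq => /eqP ->.
by rewrite gt0_muley// lte_fin.
Qed.

Lemma Jhat_pert_le d pi x : policies S pi ->
  Jhat_pert S d x <= Jpol S pi x + d%:E * notdest_sum S pi x.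
Proof. by move=> piP; apply: ereal_inf_lbound; exists pi. Qed.

Lemma Jhat_ge_bellman x : bellman S (Jhat S) x <= Jhat S x.
Proof.
rewrite bellmanE; last exact: Jhat_ge0.
apply: le_ereal_inf_tmp => _ [pi piProper <-]; have [piP _ _] := piProper.
apply: ge_ereal_inf; exists (mean_cost S x (pi 0%N x)
    + mean_next S x (pi 0%N x) (Jhat S)); first by exists (pi 0%N x).
rewrite Jpol_rec// leeD2l// le_mean// => w pw.
by apply: ereal_inf_lbound; exists (tail pi) => //; exact: proper_at_tail.
Qed.

(** No cost is incurred at the destination, hence the expected cost of a stage
    is at most M times the probability of not being there. *)
Lemma stage_cost_le pi x k : policies S pi ->
  stage_cost S pi x k <= M%:E * notdest_prob S pi x k.
Proof.
elim: k pi x => [|k IH] pi x piP.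
  rewrite stage_cost0// notdest_prob0 /off_dest; case: asboolP => [->|_].
    have dP := piP 0%N (dest S).
    rewrite mule0 /mean_cost.
    under [X in expect _ X]eq_fun do rewrite cost_dest//.
    by rewrite expect_wsum /wsum !esum1 ?subee// => w _;
      rewrite ?funeposE ?funenegE ?oppe0 maxxx mule0.
  by rewrite mule1 mean_cost_le.
have tP := policies_shift piP.
rewrite (stage_costS M0 costM)// notdest_probS// -meanZ//; last first.
  by move=> y; exact: notdest_prob_ge0.
by apply: le_mean => // w _; exact: IH.
Qed.

Lemma Jpol_le pi x : policies S pi -> Jpol S pi x <= M%:E * notdest_sum S pi x.
Proof.
move=> piP; rewrite -nneseriesZl; last by move=> k _; exact: notdest_prob_ge0.
by apply: lee_nneseries => [k _ _|k _]; [exact: sc0|exact: stage_cost_le].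
Qed.

Lemma notdest_sum_dest pi : policies S pi -> notdest_sum S pi (dest S) = 0.
Proof.
move=> piP; apply: eseries0 => k _ _.
elim: k pi piP => [|k IH] pi piP.
  by rewrite notdest_prob0 /off_dest; case: asboolP.
have tP := policies_shift piP.
rewrite notdest_probS// mean_dest// ?IH// => y; exact: notdest_prob_ge0.
Qed.

Lemma proper_of_notdest pi x : policies S pi -> notdest_sum S pi x < +oo ->
  proper_at S x pi.
Proof.
move=> piP nfin; split=> //; apply: le_lt_trans (Jpol_le x piP) _.
by rewrite lte_mul_pinfty.
Qed.

End DynamicProgramming.

(** * The Bellman equation and value iteration *)

Section UniformlyProper.
Variables (R : realType) (X U : Type) (W : countType) (S : ssp R X U W).
Implicit Types (pi : nat -> X -> U) (x : X) (u : U) (V : X -> \bar R).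
Variables (M : R) (M0 : (0 <= M)%R).
Variable costM : forall x u w, (cost S x u w <= M)%R.

Lemma proper_Xhat pi x : proper_at S x pi -> Xhat S x.
Proof.
move=> piProper; have [_ Jfin _] := piProper.
by apply: le_lt_trans Jfin; apply: ereal_inf_lbound; exists pi.
Qed.

(** After k iterations, value iteration is bounded by the cost over k stages of
    any proper policy, followed by the terminal cost J_0. The latter is at most
    b off the destination because a policy that is proper at x keeps the state
    in the set where Jhat is finite. *)
Lemma value_iteration_le (J : nat -> X -> \bar R) (b : R) :
    (0 <= b)%R -> (forall x, Xhat S x -> J 0%N x <= b%:E) ->
    J 0%N (dest S) = 0 -> (forall k x, 0 <= J k x) ->
    (forall k x, J k.+1 x = bellman S (J k) x) ->
  forall k pi x, proper_at S x pi ->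
  J k x <= \sum_(0 <= i < k) stage_cost S pi x i + b%:E * notdest_prob S pi x k.
Proof.
move=> b0 J0b J0t J0 Jrec; elim=> [|k IH] pi x piProper.
  rewrite big_nil add0e notdest_prob0 /off_dest; case: asboolP => [->|_].
    by rewrite mule0 J0t.
  by rewrite mule1; apply: J0b; exact: proper_Xhat piProper.
have [piP _ _] := piProper; have tP := policies_shift piP.
rewrite Jrec bellmanE//; apply: ge_ereal_inf.
exists (mean_cost S x (pi 0%N x) + mean_next S x (pi 0%N x) (J k)).
  by exists (pi 0%N x).
rewrite big_nat_recl//= stage_cost0// -[leRHS]addeA leeD2l//.
under eq_bigr do rewrite (stage_costS M0 costM)//.
have sc0 i y : 0 <= stage_cost S (tail pi) y i.
  exact: (stage_cost_ge0 M0 costM).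
have np0 y : 0 <= notdest_prob S (tail pi) y k by exact: notdest_prob_ge0.
rewrite notdest_probS// -meanZ// -mean_sum// -meanD//; last 2 first.
- by move=> y; exact: sume_ge0.
- by move=> y; rewrite mule_ge0.
by apply: le_mean => // w pw; apply: IH; exact: (proper_at_tail M0 costM).
Qed.

Variables (pi0 : nat -> X -> U) (pi0P : policies S pi0).
Variables (c : R) (c0 : (0 <= c)%R).
Hypothesis pi0c : forall x, Xhat S x -> notdest_sum S pi0 x <= c%:E.

Lemma Jhat_dest : Jhat S (dest S) = 0.
Proof.
apply/eqP; rewrite eq_le (Jhat_ge0 M0 costM) andbT.
have pd := notdest_sum_dest pi0P.
apply: (@le_trans _ _ (Jpol S pi0 (dest S))).
  apply: ereal_inf_lbound; exists pi0 => //.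
  by apply: (proper_of_notdest M0 costM) => //; rewrite pd.
by rewrite (le_trans (Jpol_le M0 costM _ pi0P))// pd mule0.
Qed.

Lemma Jhat_pert_bound d x : (0 <= d)%R -> Xhat S x ->
  Jhat_pert S d x <= ((M + d) * c)%:E.
Proof.
move=> d0 xhat; apply: le_trans (Jhat_pert_le d x pi0P) _.
rewrite mulrDl EFinD !EFinM leeD//.
  by rewrite (le_trans (Jpol_le M0 costM _ pi0P))// lee_wpmul2l// pi0c.
by rewrite lee_wpmul2l// pi0c.
Qed.

(** Zero-cost cycles may make near-optimal policies improper, so the policy used
    after the first control u is chosen near-optimal for a perturbed problem: it
    is then proper wherever its cost is finite. As the perturbation tends to
    zero, Jhat_delta decreases to Jhat at each successor state, and the
    uniformly proper policy bounds Jhat_delta uniformly, so the expectations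
    converge too. *)
Lemma Jhat_le_bellman x : Jhat S x <= bellman S (Jhat S) x.
Proof.
have Jh0 := Jhat_ge0 M0 costM.
rewrite bellmanE//; apply: le_ereal_inf_tmp => _ [u xu <-].
have [mfin|] := ltP (mean_next S x u (Jhat S)) +oo; last first.
  rewrite leye_eq => /eqP ->; rewrite addey ?leey// -ltNye.
  by rewrite (lt_le_trans _ (mean_cost_ge0 xu)).
apply/lee_addgt0Pr => e e0; have e30 : (0 < e / 3)%R by rewrite divr_gt0.
(* Perturbations below e / 3 all admit the same bound (M + e / 3) * c. *)
pose d n : R := (e / 3 / n.+1%:R)%R.
have d0 n : (0 < d n)%R by rewrite divr_gt0.
have de n : (d n <= e / 3)%R.
  by rewrite ler_pdivrMr// ler_peMr ?ler1n// ltW.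
have p0 := prob_ge0 xu.
have [|||n nE] := wsum_dominated (p := prob S x u) p0 (h := Jhat S \o dyn S x u)
  (F := fun n w => Jhat_pert S (d n) (dyn S x u w)) (C := ((M + e / 3) * c)%R)
  (prob_sum1 xu) _ _ _ e30.
- by move=> w; exact: Jh0.
- move=> n w pw; have yhat := mean_lty xu Jh0 mfin pw.
  apply: le_trans (Jhat_pert_bound (ltW (d0 n)) yhat) _.
  by rewrite lee_fin ler_wpM2r// lerD2l.
- move=> w pw r r0 /=; set y := dyn S x u w.
  have yhat : Jhat S y < +oo := mean_lty xu Jh0 mfin pw.
  have : Jhat S y < Jhat S y + (r / 2)%:E.
    by rewrite lteDl ?ge0_fin_numE// lte_fin divr_gt0.
  move=> /ereal_inf_lt[_ [pi [piP Jfin nfin] <-] /ltW piy].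
  have : notdest_sum S pi y \is a fin_num.
    by rewrite ge0_fin_numE// notdest_sum_ge0.
  move=> /fineK; set s := fine _ => sE.
  have s0 : (0 <= s)%R by rewrite -lee_fin sE notdest_sum_ge0.
  (* From this index on, d n * s <= r / 2. *)
  exists (Num.truncn (e / 3 * s / (r / 2)))%N => n Nn.
  apply: le_trans (Jhat_pert_le (d n) y piP) _.
  have -> : r%:E = (r / 2)%:E + (r / 2)%:E by rewrite -EFinD -splitr.
  rewrite addeA leeD// -sE -EFinM lee_fin /d mulrAC ler_pdivrMr//.
  rewrite [leRHS]mulrC -ler_pdivrMr ?divr_gt0// ltW//.
  by rewrite -truncn_le_nat.
have [||||pi piP piE] := @near_optimal _ _ _ _ S M M0 costM
  (d n) (Jhat_pert S (d n)) (e / 3).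
- exact: ltW.
- by move=> y; apply: (Jhat_pert_ge0 M0 costM); exact: ltW.
- by move=> y; apply: (Jhat_pert_bellman M0 costM); exact: ltW.
- by [].
(* The first control is u at x only, as u may be infeasible at other states. *)
pose pi' k y :=
  if k is k'.+1 then pi k' y else if asbool (y = x) then u else pi 0%N y.
have pi'P : policies S pi'.
  by move=> [|k] y //=; case: asboolP => // ->.
apply: le_trans (Jhat_le_pert M0 costM _ (d0 n)) _.
apply: (@le_trans _ _ (Jpol_pert S (d n) pi' x)).
  by apply: ereal_inf_lbound; exists pi'.
rewrite (Jpol_pert_rec M0 costM x (ltW (d0 n)) pi'P).
have -> : pi' 0%N x = u by rewrite /pi'; case: asboolP.
have Jp0 y : 0 <= Jhat_pert S (d n) y.
  by apply: (Jhat_pert_ge0 M0 costM); exact: ltW.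
have -> : e%:E = (e / 3)%:E + ((e / 3)%:E + (e / 3)%:E).
  by rewrite -!EFinD; congr EFin; lra.
rewrite [leRHS]addeACA leeD//.
  rewrite leeD2l// -[leRHS]mule1.
  apply: lee_pmul; rewrite ?lee_fin ?off_dest_ge0//.
    exact: ltW.
  by rewrite /off_dest; case: ifP.
apply: (@le_trans _ _
  (mean_next S x u (fun y => Jhat_pert S (d n) y + (e / 3)%:E))).
  by apply: le_mean.
rewrite meanD//; last by move=> _; rewrite lee_fin ltW.
by rewrite (mean_cst xu (ltW e30)) addeA leeD2r.
Qed.

Lemma Jhat_bellman : bellman_solution S (Jhat S).
Proof.
move=> x; apply/eqP.
by rewrite eq_le Jhat_le_bellman (Jhat_ge_bellman M0 costM).
Qed.

Lemma Jhat_calB : calB S (Jhat S).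
Proof.
split; first by split; [exact: (Jhat_ge0 M0 costM)|exact: Jhat_dest].
apply: (@le_lt_trans _ _ (M * c)%:E); last exact: ltry.
apply: ge_ereal_sup => _ [x xhat <-].
apply: (@le_trans _ _ (Jpol S pi0 x)).
  apply: ereal_inf_lbound; exists pi0 => //.
  apply: (proper_of_notdest M0 costM) => //.
  by apply: le_lt_trans (pi0c xhat) _; exact: ltry.
by rewrite (le_trans (Jpol_le M0 costM _ pi0P))// EFinM lee_wpmul2l// pi0c.
Qed.

Lemma bellman_mono V1 V2 x : (forall y, 0 <= V1 y) -> (forall y, V1 y <= V2 y) ->
  bellman S V1 x <= bellman S V2 x.
Proof.
move=> V10 V12; have V20 y : 0 <= V2 y by exact: le_trans (V12 y).
rewrite !bellmanE//; apply: le_ereal_inf_tmp => _ [u xu <-].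
apply: ge_ereal_inf; exists (mean_cost S x u + mean_next S x u V1).
  by exists u.
by rewrite leeD2l// le_mean.
Qed.

(** Jhat is a fixed point below J_0, hence below every J_k; in the upper bound
    by a proper policy the terminal term vanishes, since the r_k are
    summable. *)
Lemma value_iteration_cvg (J : nat -> X -> \bar R) :
    calB S (J 0%N) -> (forall x, Jhat S x <= J 0%N x) ->
    (forall k x, J k.+1 x = bellman S (J k) x) ->
  forall x, J k x @[k --> \oo] --> Jhat S x.
Proof.
move=> [[J00 J0t] J0sup] J0ge Jrec x.
have Jh0 := Jhat_ge0 M0 costM.
have Jge k y : Jhat S y <= J k y.
  elim: k y => [|k IH] y //.
  by rewrite Jrec Jhat_bellman; exact: bellman_mono.
have J0 k y : 0 <= J k y by exact: le_trans (Jge k y).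
have [b b0 J0b] := ereal_sup_image_bound J0sup.
apply: limn_esup_le_cvg => //.
apply: le_ereal_inf_tmp => _ [pi piProper <-].
have [piP Jfin nfin] := piProper.
have n0 k : 0 <= notdest_prob S pi x k by exact: notdest_prob_ge0.
pose r N := \sum_(N <= k <oo) notdest_prob S pi x k.
have Jr k : J k x <= Jpol S pi x + b%:E * r k.
  apply: le_trans (value_iteration_le b0 J0b J0t J0 Jrec k piProper) _.
  rewrite leeD//.
    by apply: nneseries_lim_ge => i _ _; exact: (stage_cost_ge0 M0 costM).
  (* The k-th term is part of the tail from k on. *)
  rewrite lee_wpmul2l// /r (nneseries_split _ 1)//.
  by rewrite addn1 big_nat1 leeDl// nneseries_ge0.
have cvgh : Jpol S pi x + b%:E * r k @[k --> \oo] --> Jpol S pi x.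
  rewrite -[X in _ --> X]adde0 -(mule0 b%:E).
  apply: cvgeD; first by rewrite mule0 fin_num_adde_defl.
    exact: cvg_cst.
  apply: cvgeZl => //; exact: nneseries_tail_cvg.
rewrite -(cvg_lim _ cvgh)// -is_cvg_limn_esupE; last first.
  by apply/cvg_ex; eexists; exact: cvgh.
apply: le_ereal_inf_tmp => _ [A FA <-]; apply: ge_ereal_inf.
exists (ereal_sup ((fun k => J k x) @` A)); first by exists A.
apply: ge_ereal_sup => _ [k Ak <-]; apply: le_trans (Jr k) _.
by apply: ereal_sup_ubound; exists k.
Qed.

(** The value V is at least the cost, up to e, of a policy that is greedy
    for V. *)
Lemma Jstar_le_solution V : (forall x, 0 <= V x) -> bellman_solution S V ->
  forall x, Jstar S x <= V x.
Proof.
move=> V0 VT x; apply/lee_addgt0Pr => e e0.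
have VT0 y : pert_bellman S 0 V y <= V y.
  rewrite [leRHS]VT bellmanE// /pert_bellman.
  by under eq_fun do rewrite pert_cost0.
have [pi piP piV] := near_optimal M0 costM (lexx 0%R) V0 VT0 e0.
by apply: ge_ereal_inf; exists (Jpol S pi x); [exists pi|rewrite -Jpol_pert0].
Qed.

Lemma solution_unique V : calWb S V -> bellman_solution S V -> V = Jhat S.
Proof.
move=> [VB VJ] VT; apply/funext => x.
have cvgV := @value_iteration_cvg (fun=> V) VB VJ (fun=> VT) x.
by apply: cvg_unique cvgV; [exact: ereal_hausdorff|exact: cvg_cst].
Qed.

End UniformlyProper.

Local Close Scope ereal_scope.

Theorem proposition7 (R : realType) (X U : Type) (W : countType)
    (S : ssp R X U W)
    (hbounded : bounded_cost S)
    (hproper : exists pi : nat -> X -> U, uniformly_proper S pi)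
    (hQW : (exists delta : R, 0 < delta /\
              forall x u, Xstar S x -> feasible S x u ->
                (Qstar_pert S delta x u < +oo)%E)
           \/ finite_set [set: W]) :
  [/\ unique_bellman_solution_in S (calWb S) (Jhat S),
      Jhat S = Jstar S ->
        unique_bellman_solution_in S (calB S) (Jstar S) &
      forall J : nat -> X -> \bar R,
        calB S (J 0%N) -> (forall x, (Jhat S x <= J 0%N x)%E) ->
        (forall k x, J k.+1 x = bellman S (J k) x) ->
        forall x, J k x @[k --> \oo] --> Jhat S x].
Proof.
have [M M0 supM] := ereal_sup_image_bound hbounded.
have costM x u w : (cost S x u w <= M)%R.
  by have := supM (x, u, w) I; rewrite lee_fin.
have [pi0 [pi0P supn]] := hproper.
have [c c0 pi0c] := ereal_sup_image_bound supn.
have JhatB := Jhat_calB M0 costM pi0P pi0c.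
have JhatT := Jhat_bellman M0 costM pi0P c0 pi0c.
have uniq := solution_unique M0 costM pi0P c0 pi0c.
split.
- split=> [|//|J JW JT]; first by split.
  exact: uniq.
- move=> JJ; rewrite -JJ; split=> // J JB JT; apply: uniq => //; split=> // x.
  rewrite JJ; apply: (Jstar_le_solution M0 costM) => //.
  by case: JB => -[].
- exact: (value_iteration_cvg M0 costM pi0P c0 pi0c).
Qed.
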